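(* If $s = 2mr$ for some integer $m \geq 1$ and $p$ is an odd prime, then there is a natural injective map $$\operatorname{Gr}_{k,n}(\mathbb{F}_{p^r}) \hookrightarrow \operatorname{Gr}^{\geq 0}_{k,n}(\mathbb{F}_{p^s})$$ and thus $$|\operatorname{Gr}^{\geq 0}_{k,n}(\mathbb{F}_{p^s})| \geq |\operatorname{Gr}_{k,n}(\mathbb{F}_{p^r})|.$$
   Context: Here $r \geq 1$ is an integer and $0 \leq k \leq n$ are integers. $\mathbb{F}_q$ is the finite field with $q$ elements. When $r$ divides $s$, $\mathbb{F}_{p^s}$ contains exactly one copy of $\mathbb{F}_{p^r}$, and $\mathbb{F}_{p^r}$ is viewed as a subset of $\mathbb{F}_{p^s}$. For $a \in \mathbb{F}_q$, write $a \geq 0$ if $a = x^2$ has a solution $x \in \mathbb{F}_q$ (this depends on the ambient field $\mathbb{F}_q$). For a field $\mathbb{F}$, $\operatorname{Gr}_{k,n}(\mathbb{F})$ is the set of $k$-dimensional subspaces of $\mathbb{F}^n$. For a full rank $k \times n$ matrix $A$, $[A]$ denotes its row span, and for a $k$-element subset $I$ of $[n]=\{1,\dots,n\}$, $\Delta_I(A)$ is the maximal minor of $A$ with columns indexed by $I$. The totally nonnegative finite Grassmannian is $$\operatorname{Gr}_{k,n}^{\geq 0}(\mathbb{F}_q) = \{V \in \operatorname{Gr}_{k,n}(\mathbb{F}_q) : \text{there is a matrix } A \text{ with } [A] = V \text{ and } \Delta_I(A) \geq 0 \text{ for all } k\text{-element } I \subseteq [n]\}.$$ *)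

(* Defs.v *)
From HB Require Import structures.
From mathcomp Require Import all_boot all_order all_algebra.

Set Implicit Arguments.
Unset Strict Implicit.
Unset Printing Implicit Defensive.

Import GRing.Theory.
Local Open Scope ring_scope.

(* Subspaces are stored as canonical matrices, so over a finite field they form
   a finite type and #|_| makes sense on sets of subspaces. The subtype
   instance used by the next two commands is only visible after this Import. *)
Import VectorInternalTheory.
HB.instance Definition _ (F : finFieldType) (vT : vectType F) :=
  [Countable of {vspace vT} by <:].
HB.instance Definition _ (F : finFieldType) (vT : vectType F) :=
  [Finite of {vspace vT} by <:].

Definition Gr (F : finFieldType) (k n : nat) : {set {vspace 'rV[F]_n}} :=
  [set V : {vspace 'rV[F]_n} | \dim V == k].

Definition rowspan (F : fieldType) (k n : nat) (A : 'M[F]_(k, n)) :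
  {vspace 'rV[F]_n} := <<[seq row i A | i : 'I_k]>>%VS.

Notation ksubset k n := {I : {set 'I_n} | #|I| == k}.

(* The j-th smallest element of I: enum_val lists a subset of 'I_n in
   increasing order. *)
Definition ksubset_nth (k n : nat) (I : ksubset k n) (j : 'I_k) : 'I_n :=
  enum_val (cast_ord (esym (eqP (valP I))) j).

Definition maxminor (R : comNzRingType) (k n : nat) (A : 'M[R]_(k, n))
  (I : ksubset k n) : R := \det (colsub (ksubset_nth I) A).

(* The relation "a >= 0" in F: a is a square in F, zero included. *)
Definition sqnonneg (F : finFieldType) (a : F) : bool :=
  [exists x : F, a == x ^+ 2].

(* For V of dimension k, a k x n matrix with row span V is automatically of
   full rank. *)
Definition Grnonneg (F : finFieldType) (k n : nat) : {set {vspace 'rV[F]_n}} :=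
  [set V in Gr F k n | [exists A : 'M[F]_(k, n),
     (rowspan A == V) && [forall I : ksubset k n, sqnonneg (maxminor A I)]]].

(* Extension of scalars along iota : F -> L: the L-span in L^n of the vectors
   of V, with F regarded as a subfield of L through iota. *)
Definition scalext (F L : finFieldType) (iota : {rmorphism F -> L}) (n : nat)
  (V : {vspace 'rV[F]_n}) : {vspace 'rV[L]_n} :=
  <<[seq map_mx iota v | v : 'rV[F]_n in V]>>%VS.

(* Main.v *)
From HB Require Import structures.
Require Import Defs.
From mathcomp Require Import all_boot all_order all_algebra.
From mathcomp Require Import all_fingroup all_solvable all_field.
Import GRing.Theory.
Local Open Scope ring_scope.

(** Write q for the order of F, so that L has order q ^ (2m). The point is that
every element of F becomes a square in L (sqnonneg_even_degree): a nonsquare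
of F acquires a square root in the quadratic extension of F, and an extension of
even degree contains that one. Hence if A is a matrix over F with row span V, all
maximal minors of A, which are elements of F, turn into squares of L, and A
itself, read over L, witnesses that the L-span of V is totally nonnegative
(scalext_Grnonneg). Extension of scalars preserves dimension and is injective
because ranks of matrices over F and inclusions between their row spaces are the
same over L as over F; the translation between subspaces and row spaces of
matrices is mem_rowspan, dim_rowspan and rowspan_surj.

The inequality of cardinalities needs in addition some embedding of F into L
(finField_embedding).

Both facts about finite fields come from one principle, dvdp_Xcard_root: as
'X^#|L| - 'X splits over L, every nonconstant divisor of it has a root in L.
It is applied to 'X^2 - a for the squares, and to the minimal polynomial over
the prime field of a generator of F for the embedding. *)

Lemma dvdp_Xcard_root (L : finFieldType) (P : {poly L}) :
  P %| 'X^#|L| - 'X -> size P != 1%N -> exists y, root P y.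
Proof.
rewrite finField_genPoly => /dvdp_prod_XsubC[b eqP] sizeP.
move: (mask b _) eqP => [|y s] eqP.
  by rewrite big_nil in eqP; rewrite (eqp_size eqP) size_poly1 in sizeP.
by exists y; rewrite (eqp_root eqP) root_prod_XsubC inE eqxx.
Qed.

Lemma expf_card_exp (F : finFieldType) (d : nat) (x : F) :
  x ^+ (#|F| ^ d) = x.
Proof.
by elim: d => [|d IHd]; rewrite ?expr1 // expnS mulnC exprM IHd expf_card.
Qed.

(** For a nonzero a in F we have a ^+ (q ^ m - 1) = 1, and q ^ (2m) - 1 is
2 (q ^ m - 1) times (q ^ m + 1) / 2, an integer because q is odd. So 'X^2 - a
divides ('X^2)^N - a^N = 'X^(2N) - 1 with 2N = q ^ (2m) - 1, hence 'X^#|L| - 'X. *)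
Lemma sqnonneg_even_degree (F L : finFieldType) (m : nat)
    (iota : {rmorphism F -> L}) :
  odd #|F| -> #|L| = (#|F| ^ (2 * m))%N ->
  forall a, sqnonneg (iota a).
Proof.
move=> oddF cardL a.
set q := #|F| in oddF cardL.
have q_gt0 : (0 < q ^ m)%N by rewrite expn_gt0 odd_gt0.
have [->|a_neq0] := eqVneq a 0.
  by apply/existsP; exists 0; rewrite rmorph0 expr0n.
have oddQ : odd (q ^ m) by rewrite oddX oddF orbT.
pose h := (q ^ m).-1; pose e := (q ^ m).+1./2.
have cardL1 : #|L| = (2 * (h * e)).+1.
  have -> : (2 * (h * e) = h * (e.*2))%N by rewrite mulnCA mul2n.
  rewrite cardL mulnC expnM even_halfK; last by rewrite /= oddQ.
  rewrite /h; case: (q ^ m)%N q_gt0 => // t _.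
  by rewrite -mulnn mulSn (mulnS t t.+1) addSn.
have ah1 : a ^+ h = 1.
  apply: (mulfI a_neq0); rewrite -exprS mulr1 /h prednK //.
  exact: expf_card_exp.
have [||y] := @dvdp_Xcard_root L ('X^2 - (iota a)%:P).
- have -> : 'X^#|L| - 'X =
      'X * (('X^2) ^+ (h * e) - (iota a)%:P ^+ (h * e)) :> {poly L}.
    rewrite -polyC_exp -rmorphXn [a ^+ _]exprM ah1 expr1n rmorph1.
    by rewrite mulrBr mulr1 -exprM cardL1 exprS.
  by rewrite subrXX mulrCA dvdp_mulr.
- by rewrite size_XnsubC.
rewrite /root !hornerE subr_eq0 => /eqP <-.
by apply/existsP; exists y.
Qed.

(** Let x generate the multiplicative group of F, let mu be its minimal
polynomial over 'F_p and let y be a root of mu in L. Every element of F is P(x)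
for some P over 'F_p, and P(x) |-> P(y) is well defined because P(x) = 0 forces
mu to divide P. The embedding is not canonical: it depends on the choice
of y. *)
Lemma finField_embedding (p r d : nat) (F L : finFieldType) :
  prime p -> #|F| = (p ^ r)%N -> #|L| = (#|F| ^ d)%N ->
  inhabited {rmorphism F -> L}.
Proof.
move=> p_prime cardF cardL.
have pcharF : p \in [pchar F] by apply: card_finPcharP cardF p_prime.
have pcharL : p \in [pchar L].
  by apply: (@card_finPcharP _ _ (r * d)%N) => //; rewrite cardL cardF expnM.
pose FF := pPrimeCharType pcharF; pose LL := pPrimeCharType pcharL.
pose jF : {rmorphism 'F_p -> FF} := in_alg FF.
pose jL : {rmorphism 'F_p -> LL} := in_alg LL.
have [u Gu] := cyclicP (field_unit_group_cyclic [set: {unit F}]%G).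
pose x : FF := val u.
have evalx_surj (a : F) :
    exists P : {poly 'F_p}, (map_poly jF P).[x] == a :> F.
  have [->|a_neq0] := eqVneq a 0.
    by exists 0; rewrite rmorph0 horner0.
  have ua : a \is a GRing.unit by rewrite unitfE.
  have /cycleP[i eq_i] : FinRing.unit F ua \in <[u]>%g by rewrite -Gu inE.
  exists 'X^i; rewrite map_polyXn hornerXn.
  by rewrite -(FinRing.val_unitX i u) -eq_i.
have [mu mu_min] : exists mu : {poly 'F_p},
    forall P, root (map_poly jF P) x = (mu %| P).
  have /polyOver1P[mu mu_def] := minPolyOver 1%AS x.
  exists mu => P; rewrite -(dvdp_map jF) -mu_def.
  apply/idP/idP => [rootP|mu_P]; last exact: root_dvdp mu_P (root_minPoly _ _).
  by apply: minPoly_dvdp => //; apply/polyOver1P; exists P.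
(* x is a root of 'X^#|L| - 'X because #|L| is a power of #|F|. *)
have [y root_y] : exists y, root (map_poly jL mu) y.
  apply: (@dvdp_Xcard_root L).
    have -> : 'X^#|L| - 'X = map_poly jL ('X^#|L| - 'X) :> {poly L}.
      by rewrite rmorphB /= map_polyXn map_polyX.
    rewrite (dvdp_map jL) -mu_min rmorphB /= map_polyXn map_polyX.
    by rewrite /root !hornerE cardL subr_eq0; apply/eqP/(expf_card_exp F).
  rewrite size_map_poly; apply/negP => /eqP size_mu.
  have : mu %| 1 by rewrite dvdp1 size_mu.
  by rewrite -mu_min rmorph1 rootC oner_eq0.
have eval_eq P Q : (map_poly jF P).[x] = (map_poly jF Q).[x] ->
    (map_poly jL P).[y] = (map_poly jL Q).[y].
  move=> eqPQ; apply/eqP; rewrite -subr_eq0 -hornerN -hornerD -rmorphB.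
  apply: root_dvdp root_y; rewrite dvdp_map -mu_min.
  by rewrite rmorphB /root hornerD hornerN eqPQ subrr.
pose lift a := xchoose (evalx_surj a).
have liftP a : (map_poly jF (lift a)).[x] = a := eqP (xchooseP (evalx_surj a)).
pose f (a : F) : L := (map_poly jL (lift a)).[y].
have f_zmod : zmod_morphism f.
  move=> a b; rewrite /f -hornerN -hornerD -rmorphB; apply: eval_eq.
  by rewrite rmorphB hornerD hornerN !liftP.
have f_monoid : monoid_morphism f.
  split=> [|a b]; rewrite /f.
    by apply: etrans (eval_eq _ 1 _) _; rewrite ?liftP rmorph1 hornerC.
  rewrite -hornerM -rmorphM; apply: eval_eq.
  by rewrite rmorphM hornerM !liftP.
pose fA := GRing.isZmodMorphism.Build F L f f_zmod.
pose fM := GRing.isMonoidMorphism.Build F L f f_monoid.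
pose iota : {rmorphism F -> L} := HB.pack f fA fM.
exact: inhabits iota.
Qed.

Lemma mem_rowspan (F : fieldType) (k n : nat) (A : 'M[F]_(k, n))
    (v : 'rV[F]_n) :
  (v \in rowspan A) = (v <= A)%MS.
Proof.
apply/idP/idP => [|/submxP[w ->]].
  rewrite /rowspan => /coord_span ->; apply: summx_sub => i _.
  apply: scalemx_sub; set w := _`_i.
  have /imageP[j _ ->] : w \in [seq row j A | j : 'I_k].
    by rewrite mem_nth // size_tuple.
  exact: row_sub.
rewrite mulmx_sum_row; apply: memv_suml => i _.
by rewrite memvZ // memv_span // image_f.
Qed.

Lemma rowspan_eqP (F : fieldType) (k l n : nat) (A : 'M[F]_(k, n))
    (B : 'M[F]_(l, n)) :
  reflect (rowspan A = rowspan B) (A == B)%MS.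
Proof.
apply: (iffP eqmxP) => [eqAB|eqAB].
  by apply/vspaceP => v; rewrite !mem_rowspan eqAB.
apply/eqmxP/andP; split; apply/row_subP => i; rewrite -mem_rowspan.
  by rewrite -eqAB mem_rowspan row_sub.
by rewrite eqAB mem_rowspan row_sub.
Qed.

(** The rows of A itself need not be independent, so the spanning family is
replaced by the rows of row_base A, which are free and number \rank A. *)
Lemma dim_rowspan (F : fieldType) (k n : nat) (A : 'M[F]_(k, n)) :
  \dim (rowspan A) = \rank A.
Proof.
have /rowspan_eqP <- : (row_base A == A)%MS by apply/eqmxP/eq_row_base.
have sizeB : size [seq row i (row_base A) | i : 'I_(\rank A)] == \rank A.
  by rewrite size_image card_ord.
rewrite /rowspan -[RHS](eqP sizeB); apply/eqP.
apply/(@freeP _ _ _ (Tuple sizeB)) => c sum0 i.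
have nthB (j : 'I_(\rank A)) : (Tuple sizeB)`_j = row j (row_base A).
  by rewrite (nth_map j) ?nth_ord_enum // size_enum_ord.
have : (\row_j c j) *m row_base A = 0.
  by rewrite mulmx_sum_row -[RHS]sum0; apply: eq_bigr => j _; rewrite mxE nthB.
rewrite -(mul0mx _ (row_base A)) => /(row_free_inj (row_base_free A)).
by move/rowP/(_ i); rewrite !mxE.
Qed.

Lemma rowspan_surj (F : fieldType) (n : nat) (V : {vspace 'rV[F]_n}) :
  exists A : 'M[F]_(\dim V, n), rowspan A = V.
Proof.
exists (\matrix_i (vbasis V)`_i); rewrite -[RHS](span_basis (vbasisP V)).
apply/eqP; rewrite eqEsubv; apply/andP; split; apply/span_subvP => v.
  move/imageP=> [i _ ->]; rewrite rowK memv_span // mem_nth //.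
  by rewrite size_tuple.
move/(nthP 0)=> [i]; rewrite size_tuple => lt_i <-.
rewrite mem_rowspan.
rewrite -(rowK (fun j : 'I_(\dim V) => (vbasis V)`_j) (Ordinal lt_i)).
exact: row_sub.
Qed.

Lemma scalext_rowspan (F L : finFieldType) (iota : {rmorphism F -> L})
    (k n : nat) (A : 'M[F]_(k, n)) :
  scalext iota (rowspan A) = rowspan (map_mx iota A).
Proof.
apply/eqP; rewrite eqEsubv; apply/andP; split; apply/span_subvP => v.
  move/imageP=> [u]; rewrite mem_rowspan => uA ->.
  by rewrite mem_rowspan map_submx.
move/imageP=> [i _ ->]; rewrite -map_row memv_span //.
by apply: image_f; rewrite mem_rowspan row_sub.
Qed.

(** Inclusion of row spaces over F can be tested after mapping to L, since it
amounts to the vanishing of a matrix with entries in F. *)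
Lemma scalext_inj (F L : finFieldType) (iota : {rmorphism F -> L}) (n : nat) :
  injective (scalext iota (n := n)).
Proof.
move=> V W; have [A <-] := rowspan_surj F n V; have [B <-] := rowspan_surj F n W.
rewrite !scalext_rowspan => /rowspan_eqP; rewrite !map_submx.
by move/rowspan_eqP.
Qed.

Lemma maxminor_map (R S : comNzRingType) (f : {rmorphism R -> S}) (k n : nat)
    (A : 'M[R]_(k, n)) (I : ksubset k n) :
  maxminor (map_mx f A) I = f (maxminor A I).
Proof. by rewrite /maxminor -det_map_mx map_mxsub. Qed.

Lemma scalext_Grnonneg (F L : finFieldType) (iota : {rmorphism F -> L})
    (k n : nat) (V : {vspace 'rV[F]_n}) :
  (forall a, sqnonneg (iota a)) -> V \in Gr F k n ->
  scalext iota V \in Grnonneg L k n.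
Proof.
move=> sq; rewrite inE => /eqP <-; have [A defV] := rowspan_surj F n V.
rewrite !inE -{1}defV scalext_rowspan dim_rowspan mxrank_map -dim_rowspan.
rewrite defV eqxx; apply/existsP; exists (map_mx iota A).
rewrite -scalext_rowspan defV eqxx; apply/forallP => I.
by rewrite maxminor_map.
Qed.

Theorem theorem3p3 (p r s m k n : nat) (F L : finFieldType)
    (p_prime : prime p) (p_odd : odd p)
    (r_ge1 : (1 <= r)%N) (m_ge1 : (1 <= m)%N) (s_def : s = (2 * m * r)%N)
    (le_kn : (k <= n)%N)
    (cardF : #|F| = (p ^ r)%N) (cardL : #|L| = (p ^ s)%N) :
  (forall iota : {rmorphism F -> L},
     [/\ forall A : 'M[F]_(k, n),
           scalext iota (rowspan A) = rowspan (map_mx iota A),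
         {in Gr F k n, forall V, scalext iota V \in Grnonneg L k n}
       & {in Gr F k n &, injective (scalext iota (n := n))}])
  /\ (#|Gr F k n| <= #|Grnonneg L k n|)%N.
Proof.
have cardLF : #|L| = (#|F| ^ (2 * m))%N.
  by rewrite cardL cardF s_def -expnM mulnC.
have nonneg (iota : {rmorphism F -> L}) :
    {in Gr F k n, forall V, scalext iota V \in Grnonneg L k n}.
  move=> V; apply: scalext_Grnonneg; apply: sqnonneg_even_degree cardLF => //.
  by rewrite cardF oddX p_odd orbT.
split=> [iota|].
  split=> [A||V W _ _]; [exact: scalext_rowspan | exact: nonneg |].
  exact: scalext_inj.
have [iota] := finField_embedding _ _ _ _ _ p_prime cardF cardLF.
rewrite -(card_imset _ (scalext_inj F L iota n)); apply: subset_leq_card.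
by apply/subsetP => _ /imsetP[V GrV ->]; apply: nonneg.
Qed.
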